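(* For all real $\alpha\in[0,2]$, $$\sup_{(X,Y)\in\mathcal{C}}\mathbb{E}|X-Y|^{\alpha}=\sup_{(X,Y)\in\mathcal{C}_{\mathcal I}}\mathbb{E}|X-Y|^{\alpha}=2^{-\alpha}.$$
   Context: A pair $(X,Y)$ of random variables on a common probability space $(\Omega,\mathcal F,\mathbb P)$ is called coherent if there exist an event $A\in\mathcal F$ and sub-$\sigma$-fields $\mathcal G,\mathcal H\subset\mathcal F$ such that $X=\mathbb P(A|\mathcal G)=\mathbb E(\mathbf 1_A|\mathcal G)$ and $Y=\mathbb P(A|\mathcal H)=\mathbb E(\mathbf 1_A|\mathcal H)$. $\mathcal C$ denotes the family of all coherent pairs; suprema over it are taken over all probability spaces, all events $A$ and all sub-$\sigma$-fields $\mathcal G,\mathcal H$. $\mathcal C_{\mathcal I}$ denotes the family of those $(X,Y)\in\mathcal C$ for which $X$ and $Y$ are independent. *)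

(* Defs.v *)
From HB Require Import structures.
From mathcomp Require Import all_boot all_order all_algebra.
From mathcomp Require Import all_classical all_reals all_analysis.

Set Implicit Arguments.
Unset Strict Implicit.
Unset Printing Implicit Defensive.

Import Order.TTheory GRing.Theory Num.Theory.
Import numFieldNormedType.Exports.

Local Open Scope classical_set_scope.
Local Open Scope ring_scope.

Definition sub_sigma_field {d : measure_display} {T : measurableType d}
    (G : set_system T) : Prop :=
  sigma_algebra setT G /\ G `<=` measurable.

(* Conditional expectations are only defined up to almost sure equality:
   "X = E(Z | G)" means that X is a version of it. *)
Definition is_cond_exp {d : measure_display} {T : measurableType d}
    {R : realType} (P : probability T R) (G : set_system T) (Z X : T -> R)
    : Prop :=
  [/\ forall B : set R, measurable B -> G (X @^-1` B),
      P.-integrable setT (EFin \o X) &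
      forall C : set T, G C ->
        (\int[P]_(w in C) (X w)%:E = \int[P]_(w in C) (Z w)%:E)%E].

Definition is_cond_prob {d : measure_display} {T : measurableType d}
    {R : realType} (P : probability T R) (G : set_system T) (A : set T)
    (X : T -> R) : Prop :=
  is_cond_exp P G \1_A X.

Definition coherent {d : measure_display} {T : measurableType d}
    {R : realType} (P : probability T R) (X Y : {RV P >-> R}) : Prop :=
  exists (A : set T) (G H : set_system T),
    [/\ measurable A, sub_sigma_field G, sub_sigma_field H,
        is_cond_prob P G A X & is_cond_prob P H A Y].

Definition independent_RV2 {d : measure_display} {T : measurableType d}
    {R : realType} (P : probability T R) (X Y : {RV P >-> R}) : Prop :=
  forall B C : set R, measurable B -> measurable C ->
    P (X @^-1` B `&` Y @^-1` C) = (P (X @^-1` B) * P (Y @^-1` C))%E.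

Definition coherent_moments (R : realType) (alpha : R) : set (\bar R) :=
  [set v | exists (d : measure_display) (T : measurableType d)
             (P : probability T R) (X Y : {RV P >-> R}),
             coherent X Y /\
             v = ('E_P[fun w => (`|X w - Y w| `^ alpha)%R])%E].

Definition independent_coherent_moments (R : realType) (alpha : R)
    : set (\bar R) :=
  [set v | exists (d : measure_display) (T : measurableType d)
             (P : probability T R) (X Y : {RV P >-> R}),
             [/\ coherent X Y, independent_RV2 X Y &
             v = ('E_P[fun w => (`|X w - Y w| `^ alpha)%R])%E]].

(* Main.v *)
(* Put Z = 1_A.  Since E[(X - 1/2)(X - Z)] = 0, the centred variable X - 1/2
   lies on the sphere of L^2 having the segment from 0 to Z - 1/2 as a diameter,
   and so does Y - 1/2.  As |Z - 1/2| = 1/2, the diameter is 1/2, whence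
   E|X - Y|^2 <= 1/4, and the case alpha <= 2 follows by Jensen.  Both steps are
   carried out pointwise at once in [dist_powR_le], which is then integrated.
   Equality holds for the independent pair (1_A, 1/2) with P(A) = 1/2. *)

Require Import Defs.
From HB Require Import structures.
From mathcomp Require Import all_boot all_order all_algebra.
From mathcomp Require Import all_classical all_reals all_analysis.
From mathcomp Require Import finmap measurable_realfun ring lra.

Import Order.TTheory GRing.Theory Num.Theory.
Import numFieldNormedType.Exports.
Import HBNNSimple.

Local Open Scope classical_set_scope.
Local Open Scope ring_scope.

(** * Vanishing integrals and null sets *)

Section integration.
Context {d : measure_display} {T : measurableType d} {R : realType}.

Lemma integral_comp_mul_eq0 (mu : {measure set T -> \bar R}) (X W : T -> R)
    (f : R -> R) (M : R) :
    measurable_fun setT X -> mu.-integrable setT (EFin \o W) ->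
    (forall B : set R, measurable B ->
      (\int[mu]_(w in X @^-1` B) (W w)%:E = 0)%E) ->
    measurable_fun setT f -> (forall x, 0 <= f x <= M) ->
  (\int[mu]_w (f (X w) * W w)%:E = 0)%E.
Proof.
move=> mX iW W0 mf fM.
have mW : measurable_fun setT W.
  by apply/measurable_EFinP; exact: measurable_int iW.
have mEf : measurable_fun setT (EFin \o f) by exact/measurable_EFinP.
have f0 x : setT x -> (0 <= (EFin \o f) x)%E.
  by move=> _; rewrite lee_fin; case/andP: (fM x).
pose g := nnsfun_approx measurableT mEf.
have gf n x : g n x <= f x.
  by rewrite -lee_fin /g nnsfun_approxE; exact: le_approx.
have gW0 n : (\int[mu]_w (g n (X w) * W w)%:E = 0)%E.
  have preB (k : R) : measurable (g n @^-1` [set k]) by exact: measurable_funPTI.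
  have mP (k : R) : measurable (X @^-1` (g n @^-1` [set k])).
    by rewrite -[X in measurable X]setTI; exact: mX.
  have iP k : mu.-integrable setT
      ((EFin \o W) \_ (X @^-1` (g n @^-1` [set k]))).
    apply/(integrable_mkcond _ (mP k)).
    exact: integrableS iW.
  have -> : (fun w => (g n (X w) * W w)%:E) =
    (fun w => \sum_(k <- fset_set (range (g n)))
      (k%:E * ((EFin \o W) \_ (X @^-1` (g n @^-1` [set k]))) w))%E.
    apply/funext => w.
    rewrite fimfunE fsbig_finite/=; last exact: fimfunP.
    rewrite mulr_suml -sumEFin; apply: eq_bigr => k _.
    by rewrite epatch_indic !EFinM -muleA [X in (_ * X)%E]muleC.
  rewrite integral_sum//; last by move=> k; exact: integrableZl.
  apply: big1 => k _.
  by rewrite integralZl// -integral_mkcond W0 ?mule0.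
have cg : (\int[mu]_w (g n (X w) * W w)%:E)%E @[n --> \oo] -->
    (\int[mu]_w (f (X w) * W w)%:E)%E.
  (* Since [0 <= g n <= f <= M], the function [M * |W|] dominates all the products. *)
  apply: (@dominated_cvg _ _ _ mu setT measurableT
    (fun n w => (g n (X w) * W w)%:E) _ (fun w => M%:E * `|(W w)%:E|)%E) => //.
  - move=> n; apply/measurable_EFinP; apply: measurable_funM => //.
    exact: measurableT_comp.
  - move=> w _.
    under eq_fun do rewrite EFinM.
    rewrite EFinM; apply: cvgeZr => //.
    exact: (cvg_nnsfun_approx measurableT mEf f0).
  - by apply: integrableZl => //; exact: integrable_abse.
  - move=> n w _.
    rewrite abse_EFin -EFinM lee_fin normrM ler_wpM2r// ger0_norm ?fun_ge0//.
    by apply: le_trans (gf n (X w)) _; case/andP: (fM (X w)).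
move: cg; under eq_fun do rewrite gW0.
by move=> /(cvg_lim (@ereal_hausdorff R)) <-; rewrite lim_cst.
Qed.

(** On [D] the function [W] equals its absolute value, so a zero integral makes [W] vanish almost
    everywhere there, against strict positivity. *)
Lemma integral_gt0_eq0_null (mu : {measure set T -> \bar R}) (D : set T)
    (W : T -> R) :
    measurable D -> mu.-integrable D (EFin \o W) ->
    (forall w, D w -> 0 < W w) -> (\int[mu]_(w in D) (W w)%:E = 0)%E ->
  {ae mu, forall w, ~ D w}.
Proof.
move=> mD iW W0 IW.
have : (\int[mu]_(w in D) `|(EFin \o W) w| = 0)%E.
  rewrite -[RHS]IW; apply: eq_integral => w /set_mem Dw.
  by rewrite /= ger0_norm// ltW// W0.
move/(ae_eq_integral_abs mu mD (measurable_int _ iW)).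
apply: filterS => w /= WD Dw.
by have := W0 _ Dw; move: (WD Dw) => [->]; rewrite ltxx.
Qed.

Lemma probability_integrable_le1 (P : probability T R) (U : T -> R) :
    measurable_fun setT U -> (forall w, `|U w| <= 1) ->
  P.-integrable setT (EFin \o U).
Proof.
move=> mU U1; apply: measurable_bounded_integrable => //.
  by rewrite (le_lt_trans (probability_le1 _ _))// ltry.
by exists 1; split => // M M1 w _; exact: le_trans (U1 w) (ltW M1).
Qed.

End integration.

(** * Tangent bound for concave powers, and truncation to the unit interval *)

Lemma powR_le_tangent {R : realType} (s a : R) : 0 <= s -> 0 <= a <= 1 ->
  s `^ a <= 1 + a * (s - 1).
Proof.
move=> s0 /andP[a0 a1].
have [->|an0] := eqVneq a 0; first by rewrite powRr0 mul0r addr0.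
have [->|an1] := eqVneq a 1; first by rewrite powRr1// mul1r addrC subrK.
have ap : 0 < a by rewrite lt_neqAle eq_sym an0.
have bp : 0 < 1 - a by rewrite subr_gt0 lt_neqAle an1.
have := @conjugate_powR R (s `^ a) 1 a^-1 (1 - a)^-1 (powR_ge0 _ _) ler01.
rewrite !invr_gt0 !invrK => /(_ ap bp).
rewrite addrC subrK => /(_ erefl).
rewrite -powRrM mulfV// powRr1// powR1 mulr1 mul1r => /le_trans; apply.
lra.
Qed.

(** A conditional probability lies in [0,1] only almost surely; truncating it gives a version
    bounded everywhere, which makes the products below integrable. *)
Definition clamp01 {R : realType} (x : R) : R := Num.max 0 (Num.min x 1).

Lemma clamp01_itv {R : realType} (x : R) : 0 <= clamp01 x <= 1.
Proof. by rewrite /clamp01 le_max lexx ge_max ler01 ge_min lexx orbT. Qed.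

Lemma measurable_clamp01 {R : realType} :
  measurable_fun setT (@clamp01 R).
Proof.
by apply: measurable_maxr => //; apply: measurable_minr.
Qed.

Lemma clamp01_id {R : realType} (x : R) :
  ~ x < 0 -> ~ 1 < x -> clamp01 x = x.
Proof.
by move=> /negP; rewrite -leNgt => x0 /negP; rewrite -leNgt => x1;
  rewrite /clamp01 min_l// max_r.
Qed.

(** * Bounded versions and orthogonality of conditional probabilities *)

Section cond_prob.
Context {d : measure_display} {T : measurableType d} {R : realType}.
Context {P : probability T R} {G : set_system T} {A : set T}.
Context (GS : sub_sigma_field G) (mA : measurable A).

Lemma integrable_event_indic : P.-integrable setT (EFin \o (\1_A : T -> R)).
Proof.
apply: probability_integrable_le1 => // w.
by rewrite indicE; case: (w \in A); rewrite ?normr0 ?normr1.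
Qed.

Lemma is_cond_prob_measurable {X : T -> R} : is_cond_prob P G A X ->
  measurable_fun setT X.
Proof. by case=> GX _ _ _ B mB; rewrite setTI; apply: GS.2; exact: GX. Qed.

Lemma integrable_cond_prob_residual {X : T -> R} : is_cond_prob P G A X ->
  P.-integrable setT (EFin \o (fun w => X w - \1_A w)).
Proof.
case=> _ iX _.
exact: integrableB iX integrable_event_indic.
Qed.

Lemma integral_cond_prob_residual {X : T -> R} {C : set T} :
  is_cond_prob P G A X -> G C -> (\int[P]_(w in C) (X w - \1_A w)%:E = 0)%E.
Proof.
case=> _ iX XA GC; have mC : measurable C by exact: GS.2.
have iAC := integrableS measurableT mC (@subsetT _ _) integrable_event_indic.
have iXC := integrableS measurableT mC (@subsetT _ _) iX.
under eq_integral do rewrite EFinB.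
by rewrite integralB// XA// subee// integrable_fin_num.
Qed.

(** The events [X < 0] and [X > 1] belong to [G], so [X - \1_A] has zero integral over each; but it
    is strictly negative on the first and strictly positive on the second, so both are null. *)
Lemma is_cond_prob_ae_clamp01 {X : T -> R} : is_cond_prob P G A X ->
  {ae P, forall w, clamp01 (X w) = X w}.
Proof.
move=> XA; have [GX iX _] := XA.
have iW := integrable_cond_prob_residual XA.
pose D0 := X @^-1` `]-oo, 0[; pose D1 := X @^-1` `]1, +oo[.
have GD0 : G D0 by apply: GX; exact: measurable_itv.
have GD1 : G D1 by apply: GX; exact: measurable_itv.
have mD0 : measurable D0 by exact: GS.2.
have mD1 : measurable D1 by exact: GS.2.
have iW0 := integrableS measurableT mD0 (@subsetT _ _) iW.
have iW1 := integrableS measurableT mD1 (@subsetT _ _) iW.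
have n0 : {ae P, forall w, ~ D0 w}.
  apply: (@integral_gt0_eq0_null _ _ _ _ _ (fun w => \1_A w - X w)) => //.
  - move: (integrableN iW0); congr (_.-integrable _ _).
    by apply/funext => w /=; rewrite opprB.
  - move=> w; rewrite /D0/= in_itv/= => X0; rewrite subr_gt0.
    by rewrite (lt_le_trans X0)// indicE ler0n.
  - under eq_integral do rewrite -opprB EFinN.
    by rewrite integralN ?integral_cond_prob_residual ?oppe0//;
      exact: integrable_add_def.
have n1 : {ae P, forall w, ~ D1 w}.
  apply: (@integral_gt0_eq0_null _ _ _ _ _ (fun w => X w - \1_A w)) => //.
  - move=> w; rewrite /D1/= in_itv/= andbT => X1; rewrite subr_gt0.
    by rewrite (le_lt_trans _ X1)// indicE; case: (_ \in _).
  - exact: integral_cond_prob_residual.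
move: n0 n1; apply: filterS2 => w; rewrite /D0 /D1 /= !in_itv/= andbT.
exact: clamp01_id.
Qed.

Lemma is_cond_prob_clamp01 {X : T -> R} : is_cond_prob P G A X ->
  is_cond_prob P G A (clamp01 \o X).
Proof.
move=> XA; have mX := is_cond_prob_measurable XA.
have mcX : measurable_fun setT (clamp01 \o X).
  exact: measurableT_comp measurable_clamp01 mX.
have [GX iX XAC] := XA; split.
- move=> B mB; rewrite comp_preimage; apply: GX.
  by rewrite -[X in measurable X]setTI; exact: measurable_clamp01.
- apply: probability_integrable_le1 => // w.
  by have /andP[c0 c1] := clamp01_itv (X w); rewrite ger0_norm.
- move=> C GC; have mC : measurable C by exact: GS.2.
  rewrite -XAC//; apply: ae_eq_integral => //.
  + by apply/measurable_EFinP; exact: measurable_funTS.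
  + by apply/measurable_EFinP; exact: measurable_funTS.
  + by apply: filterS (is_cond_prob_ae_clamp01 XA) => w /= -> _.
Qed.

(** The residual [X - \1_A] is orthogonal to constants and to bounded functions of [X], since [G]
    contains the whole space and all events determined by [X]. *)
Lemma cond_prob_orthogonal {X : T -> R} : is_cond_prob P G A X ->
    (forall w, 0 <= X w <= 1) ->
  (\int[P]_w ((X w - 2^-1) * (X w - \1_A w))%:E = 0)%E.
Proof.
move=> XA X01; have mX := is_cond_prob_measurable XA.
have [GX _ _] := XA.
have iW := integrable_cond_prob_residual XA.
have bX : [bounded X w | w in setT].
  exists 1; split => // M M1 x _ /=.
  have /andP[c0 c1] := X01 x.
  by rewrite ger0_norm// (le_trans c1)// ltW.
under eq_integral do rewrite mulrBl EFinB.
rewrite integralB//; last 2 first.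
- exact: integrableMr iW.
- exact: integrableZl iW.
under [X in (_ - X)%E]eq_integral do rewrite EFinM.
rewrite integralZl// (integral_cond_prob_residual XA) ?mule0 ?sube0//; last first.
  by case: GS => -[G0 GC _] _; rewrite -(setD0 setT); exact: GC.
(* The identity is unbounded on the real line, so the factor [X] is rewritten as [clamp01] of [X], a
   function with values in [0,1] everywhere. *)
under eq_integral => w _.
  rewrite -[X in (X * _)%:E](_ : clamp01 (X w) = _); last first.
    case/andP: (X01 w) => x0 x1.
    by apply: clamp01_id; apply/negP; rewrite -leNgt.
  over.
apply: (@integral_comp_mul_eq0 _ _ _ P X (fun w => X w - \1_A w) _ 1) => //.
- by move=> B mB; apply: integral_cond_prob_residual => //; exact: GX.
- exact: measurable_clamp01.
- exact: clamp01_itv.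
Qed.

End cond_prob.

(** * The upper bound for coherent pairs *)

Lemma dist_powR_le {R : realType} (alpha x y z : R) :
    0 <= alpha <= 2 -> z = 0 \/ z = 1 ->
  `|x - y| `^ alpha <= 2 `^ (- alpha) *
    (1 + (4 * alpha * ((x - 2^-1) * (x - z)) +
          4 * alpha * ((y - 2^-1) * (y - z)))).
Proof.
move=> /andP[a0 a2] z01.
rewrite powRN mulrC ler_pdivlMr ?powR_gt0//.
rewrite -powRM//.
(* The factor 4 places the extremal squared distance 1/4 at [s = 1], the point of tangency; the
   exponent [alpha / 2] lies in [0,1]. *)
have -> : (`|x - y| * 2) `^ alpha = (4 * (x - y) ^+ 2) `^ (alpha / 2).
  have -> : 4 * (x - y) ^+ 2 = (`|x - y| * 2) `^ 2.
    by rewrite powR_mulrn ?mulr_ge0// exprMn real_normK ?num_real//; ring.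
  by rewrite -powRrM; congr (_ `^ _); lra.
apply: le_trans (powR_le_tangent _ _ _ _) _.
- by rewrite mulr_ge0// sqr_ge0.
- lra.
rewrite -subr_ge0.
(* The gap is a perfect square because [z ^+ 2 = z]; it vanishes when [x + y = z + 1/2], that is,
   when [x] and [y] are antipodal on the sphere. *)
have -> : 1 + (4 * alpha * ((x - 2^-1) * (x - z)) +
   4 * alpha * ((y - 2^-1) * (y - z))) -
   (1 + alpha / 2 * (4 * (x - y) ^+ 2 - 1)) =
   alpha * 2 * (x + y - z - 2^-1) ^+ 2.
  by case: z01 => ->; field.
by apply: mulr_ge0; [exact: mulr_ge0|exact: sqr_ge0].
Qed.

Lemma coherent_moment_le {d : measure_display} {T : measurableType d}
    {R : realType} (P : probability T R) (X Y : {RV P >-> R}) (alpha : R) :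
    0 <= alpha <= 2 -> coherent X Y ->
  ('E_P[fun w => (`|X w - Y w| `^ alpha)%R] <= (2 `^ (- alpha))%:E)%E.
Proof.
move=> a02 [A [G [H [mA GS HS XA YA]]]].
pose X' := clamp01 \o X; pose Y' := clamp01 \o Y.
have XA' := is_cond_prob_clamp01 GS mA XA : is_cond_prob P G A X'.
have YA' := is_cond_prob_clamp01 HS mA YA : is_cond_prob P H A Y'.
have mX' := is_cond_prob_measurable GS XA'.
have mY' := is_cond_prob_measurable HS YA'.
have mdist (U V : T -> R) : measurable_fun setT U -> measurable_fun setT V ->
    measurable_fun setT (fun w => (`|U w - V w| `^ alpha)%:E).
  move=> mU mV; apply/measurable_EFinP.
  apply: (measurableT_comp (measurable_powR alpha)).
  by apply: measurableT_comp => //; exact: measurable_funB.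
rewrite unlock.
(* Passing to the truncated versions leaves the moment unchanged and makes the pointwise bound
   integrable. *)
rewrite (ae_eq_integral (fun w => (`|X' w - Y' w| `^ alpha)%:E))//; last 3 first.
- exact: mdist.
- exact: mdist.
- have := is_cond_prob_ae_clamp01 GS mA XA.
  apply: filterS2 (is_cond_prob_ae_clamp01 HS mA YA) => w.
  by rewrite /X' /Y' /= => -> -> _.
pose V (U : T -> R) w := (U w - 2^-1) * (U w - \1_A w).
have iV (U : T -> R) : measurable_fun setT U -> (forall w, 0 <= U w <= 1) ->
    P.-integrable setT (EFin \o V U).
  move=> mU U01; apply: probability_integrable_le1 => [|w].
    by apply: measurable_funM; exact: measurable_funB.
  have /andP[u0 u1] := U01 w.
  rewrite /V normrM -[leRHS]mulr1 ler_pM// ler_norml.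
    by apply/andP; split; lra.
  by rewrite indicE; case: (_ \in _) => /=; apply/andP; split; lra.
have iVX := iV _ mX' (fun w => clamp01_itv (X w)).
have iVY := iV _ mY' (fun w => clamp01_itv (Y w)).
have oX := cond_prob_orthogonal GS mA XA' (fun w => clamp01_itv (X w)).
have oY := cond_prob_orthogonal HS mA YA' (fun w => clamp01_itv (Y w)).
have i1 : P.-integrable setT (cst 1%E : T -> \bar R).
  by apply: (probability_integrable_le1 _ (cst 1)) => // w; rewrite normr1.
pose k : R := 4 * alpha.
(* This is the second factor of the pointwise bound; orthogonality removes both quadratic terms, so
   its mean is 1. *)
pose B w := (1 + (k%:E * (V X' w)%:E + k%:E * (V Y' w)%:E))%E.
have iB : P.-integrable setT B.
  by apply: integrableD => //; apply: integrableD => //; exact: integrableZl.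
have IB : (\int[P]_w B w = 1)%E.
  rewrite integralD//; last first.
    by apply: integrableD => //; exact: integrableZl.
  rewrite integralD//; [|exact: integrableZl|exact: integrableZl].
  rewrite !integralZl// oX oY !mule0 !adde0.
  by rewrite integral_cst// mul1e; exact: probability_setT.
(* The constant is written as an integral of a multiple of [B], so that a pointwise comparison
   suffices. *)
rewrite -[leRHS]mule1 -IB -integralZl//.
apply: ge0_le_integral => //.
- exact: mdist.
- exact: measurable_int (integrableZl measurableT _ iB).
- move=> w _; rewrite -[leRHS]/(((2 `^ (- alpha)) *
    (1 + (k * V X' w + k * V Y' w)))%:E) lee_fin.
  by apply: dist_powR_le => //; rewrite indicE; case: (_ \in _); [right|left].
Qed.

(** * The extremal independent pair on a fair coin *)

Section fair_coin.
Context {R : realType}.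

Let P : probability bool R := bernoulli_prob 2^-1.

Let A : set bool := [set true].

Lemma fair_coin_half : P A = (2^-1)%:E.
Proof.
rewrite -[LHS]/(bernoulli_prob (2^-1 : R) A) bernoulli_probE; last first.
  by apply/andP; split; lra.
by rewrite !diracE [true \in _]mem_set// [false \in _]memNset// mule1 mule0 adde0.
Qed.

Let mA : measurable A. Proof. by []. Qed.

Let X : {RV P >-> R} := indic_mfun A mA.
Let Y : {RV P >-> R} := cst 2^-1.

Lemma fair_coin_coherent : coherent X Y.
Proof.
(* Full information yields [\1_A] itself, and the trivial sigma-field yields the constant [P A],
   which is 1/2. *)
exists A, measurable, [set set0; setT]; split => //.
- split; last by move=> C _.
  split; first by left.
    by move=> C [->|->]; [right; rewrite setD0|left; rewrite setDT].
  move=> F F0T; have [[n Fn]|nF] := pselect (exists n, F n = setT).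
    by right; apply/seteqP; split => // x _; exists n; rewrite ?Fn.
  left; apply/seteqP; split => // x [n _].
  by have [->|Fn] := F0T n; [|case: nF; exists n].
- by split=> //; exact: integrable_event_indic.
- split.
  + move=> B _; have [Bh|Bh] := pselect (B 2^-1).
      by right; apply/seteqP; split.
    by left; apply/seteqP; split.
  + by apply: probability_integrable_le1 => // w; rewrite ger0_norm//=; lra.
  + move=> C [->|->]; first by rewrite !integral_set0.
    by rewrite integral_indic// setIT [RHS]fair_coin_half;
      have := expectation_cst P 2^-1; rewrite unlock.
Qed.

Lemma fair_coin_independent : independent_RV2 X Y.
Proof.
move=> B C mB mC; have [Ch|Ch] := pselect (C 2^-1).
  have -> : Y @^-1` C = setT by apply/seteqP; split.
  by rewrite setIT probability_setT mule1.
have -> : Y @^-1` C = set0 by apply/seteqP; split.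
by rewrite setI0 measure0 mule0.
Qed.

(** An indicator is at distance exactly 1/2 from the constant 1/2 at either outcome, so the
    integrand is constant. *)
Lemma fair_coin_moment (alpha : R) :
  ('E_P[fun w => (`|X w - Y w| `^ alpha)%R] = (2 `^ (- alpha))%:E)%E.
Proof.
rewrite (_ : (fun _ => _) = cst (2 `^ (- alpha))) ?expectation_cst//.
apply/funext => w.
have -> : `|X w - Y w| = 2^-1.
  rewrite -[X w]/(\1_A w) -[Y w]/(2^-1) indicE; case: (w \in A) => /=.
    by rewrite ger0_norm; lra.
  by rewrite sub0r normrN ger0_norm.
by rewrite -mulN1r powRrM powR_inv1.
Qed.

End fair_coin.

Theorem corollary3p2 (R : realType) (alpha : R)
    (halpha : 0 <= alpha <= 2) :
  ereal_sup (coherent_moments alpha) =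
    ereal_sup (independent_coherent_moments alpha) /\
  ereal_sup (independent_coherent_moments alpha) =
    (2 `^ (- alpha))%:E.
Proof.
have ub : (ereal_sup (coherent_moments alpha) <= (2 `^ (- alpha))%:E)%E.
  apply: ge_ereal_sup => _ [d [T [P [X [Y [XY ->]]]]]].
  exact: coherent_moment_le.
have lb : ((2 `^ (- alpha))%:E <=
    ereal_sup (independent_coherent_moments alpha))%E.
  apply: ereal_sup_ubound; do 5 eexists; split.
  - exact: fair_coin_coherent.
  - exact: fair_coin_independent.
  - by rewrite fair_coin_moment.
have sub : (ereal_sup (independent_coherent_moments alpha) <=
    ereal_sup (coherent_moments alpha))%E.
  apply: le_ereal_sup => _ [d [T [P [X [Y [XY _ ->]]]]]].
  by exists d, T, P, X, Y.
(* The two suprema are squeezed between [lb] and [ub], with [sub] linking them. *)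
by split; apply/eqP; rewrite eq_le ?sub ?lb ?(le_trans ub lb) ?(le_trans sub ub).
Qed.
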